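(* A convex body $K\subset\mathbb{C}^n$ is a (complex) ellipsoid if and only if for every complex affine line $L\subset\mathbb{C}^n$, the intersection $L\cap K$ is either empty, a single point, or a closed disk in $L$.
   Context: A convex body is a compact convex subset of $\mathbb{C}^n$ with nonempty interior. A (complex) ellipsoid in $\mathbb{C}^n$ is the image of the closed Euclidean unit ball of $\mathbb{C}^n$ under an invertible complex affine map $z\mapsto Az+b$ ($A\in GL_n(\mathbb{C})$, $b\in\mathbb{C}^n$). A complex affine line is a set $\{a+zv:z\in\mathbb{C}\}$ with $v\neq 0$; a disk in it is a closed Euclidean round disk of positive radius in that line. *)

(* Defs.v *)
From HB Require Import structures.
From mathcomp Require Import all_boot all_order all_algebra.
From mathcomp Require Import complex.
From mathcomp Require Import all_classical all_reals all_analysis.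

Set Implicit Arguments.
Unset Strict Implicit.
Unset Printing Implicit Defensive.

Import Order.TTheory GRing.Theory Num.Theory.
Import numFieldNormedType.Exports.
Local Open Scope classical_set_scope.
Local Open Scope ring_scope.
Local Open Scope complex_scope.

(* C^n is represented as column vectors 'cV[R[i]]_n.  Its topology is the
   product topology of the usual (norm) topology on R[i], i.e. the Euclidean
   topology of C^n = R^(2n). *)
Notation Cn R n := 'cV[R[i]]_n.

(* Equip R[i] with the topology induced by its modulus (the library only
   provides this via an instance on the numClosedFieldType class, which does
   not trigger canonical inference on R[i]); the matrix type then carries the
   product topology, i.e. the usual Euclidean topology of C^n. *)
HB.instance Definition _ (R : realType) :=
  PseudoPointedMetric.copy R[i] (R[i])^o.

Definition csq {R : realType} (z : R[i]) : R :=
  (complex.Re z) ^+ 2 + (complex.Im z) ^+ 2.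

Definition esq {R : realType} {n : nat} (x : Cn R n) : R :=
  \sum_(i < n) csq (x i ord0).

Definition convex_setC {R : realType} {n : nat} (K : set (Cn R n)) : Prop :=
  forall x y t, K x -> K y -> 0 <= t -> t <= 1 ->
    K ((1 - t)%:C *: x + t%:C *: y).

Definition convex_body {R : realType} {n : nat} (K : set (Cn R n)) : Prop :=
  compact K /\ convex_setC K /\ ((K°) !=set0).

Definition unit_ball {R : realType} (n : nat) : set (Cn R n) :=
  [set x | esq x <= 1].

Definition is_ellipsoid {R : realType} {n : nat} (K : set (Cn R n)) : Prop :=
  exists (A : 'M[R[i]]_n) (b : Cn R n),
    A \in unitmx /\ K = (fun z => A *m z + b) @` @unit_ball R n.

Definition complex_line {R : realType} {n : nat} (a v : Cn R n) : set (Cn R n) :=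
  [set a + z *: v | z in [set: R[i]]].

Definition is_complex_line {R : realType} {n : nat} (L : set (Cn R n)) : Prop :=
  exists a v : Cn R n, v != 0 /\ L = complex_line a v.

Definition is_disk_in {R : realType} {n : nat} (L D : set (Cn R n)) : Prop :=
  exists (c : Cn R n) (r : R), L c /\ 0 < r /\
    D = [set x | L x /\ esq (x - c) <= r ^+ 2].

(* Main.v *)
Require Import Defs.
From HB Require Import structures.
From mathcomp Require Import all_boot all_order all_algebra.
From mathcomp Require Import complex.
From mathcomp Require Import all_classical all_reals all_analysis.
From mathcomp Require Import ring lra.
Import Order.TTheory GRing.Theory Num.Theory.
Import numFieldNormedType.Exports.
Local Open Scope classical_set_scope.
Local Open Scope ring_scope.

(** Let [p] be a point of [K] farthest from the origin, moved to [0].  Then [K] lies in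
    the half-space [Re l > 0] except for the point [0], where [l] is a complex linear
    form, so the section of [K] by the line of direction [v], [l v = 1], is a disc
    tangent at [0]: [K (z v) <-> Q v * |z|^2 <= Re z].  The projective map sending the
    hyperplane [l = 0] to infinity turns the disc condition on the other lines into:
    for every complex line in the affine hyperplane [l = 1] and every real-affine
    function [A] on it, [Q <= A] defines a disc, a point or the empty set.  Hence [Q]
    agrees with an affine function on every circle, which forces
    [Q = al |z|^2 + affine] on every complex line.  Homogenizing [Q] gives a function
    [F] on the whole space satisfying the parallelogram law and [F (z y) = |z|^2 F y],
    i.e. a positive definite Hermitian form, and [K = {F <= Re l}] is an ellipsoid. *)

Set Implicit Arguments.
Unset Strict Implicit.
Unset Printing Implicit Defensive.

(** * Functions of two real variables whose affine sublevel sets are discs *)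

(** [k] carries no sign condition: the empty set and single points are covered by [k < 0] and
    [k = 0]. *)
Definition disclike (R : realFieldType) (P : R -> R -> Prop) : Prop :=
  exists cx cy k, forall x y, P x y <-> (x - cx) ^+ 2 + (y - cy) ^+ 2 <= k.

(** Intersecting chords at [m]: the points [m + e] and [m - e] of the disc make the product of
    segments at [m] at least [|e|^2], so a chord ending within [d |X|] on one side extends at least
    [|X|] on the other. *)
Lemma disc_opposite (R : realFieldType) (cx cy k mx my ex ey X Y d : R) :
  (mx + ex - cx) ^+ 2 + (my + ey - cy) ^+ 2 <= k ->
  (mx - ex - cx) ^+ 2 + (my - ey - cy) ^+ 2 <= k ->
  k < (mx - d * X - cx) ^+ 2 + (my - d * Y - cy) ^+ 2 ->
  0 < d -> d * (X ^+ 2 + Y ^+ 2) <= ex ^+ 2 + ey ^+ 2 ->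
  (mx + X - cx) ^+ 2 + (my + Y - cy) ^+ 2 <= k.
Proof.
set a := (mx + ex - cx) ^+ 2 + _; set b := (mx - ex - cx) ^+ 2 + _.
set c := (mx - d * X - cx) ^+ 2 + _; set q := (mx + X - cx) ^+ 2 + _.
move=> ha hb hc d0 hd.
have E : d * q + c = (1 + d) / 2 * (a + b)
   - (1 + d) * (ex ^+ 2 + ey ^+ 2 - d * (X ^+ 2 + Y ^+ 2)).
  by rewrite /a /b /c /q; field.
have h1 : (1 + d) / 2 * (a + b) <= (1 + d) * k.
  have : (1 + d) * (a + b) <= (1 + d) * (k + k) by apply: ler_wpM2l; lra.
  lra.
have h2 : 0 <= (1 + d) * (ex ^+ 2 + ey ^+ 2 - d * (X ^+ 2 + Y ^+ 2)).
  by apply: mulr_ge0; lra.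
by rewrite -(ler_pM2l d0); lra.
Qed.

(* Raise the affine bound on the side of [(x, y)] until it vanishes at a point [Y] beyond the
   midpoint of [p] and [q]: a disc through [p] and [q] missing such a [Y] near the midpoint
   contains [(x, y)]. *)
Lemma positive_off_line (R : realFieldType) (r : R -> R -> R) (px py qx qy x y : R) :
  (forall x y, 0 <= r x y) ->
  (forall a b c, disclike (fun x y => 1 <= r x y * (a * x + b * y + c))) ->
  0 < r px py -> 0 < r qx qy ->
  (x - px) * (qy - py) - (y - py) * (qx - px) != 0 ->
  0 < r x y.
Proof.
move=> r0 Hr rp rq.
set l := (X in X != 0) => l0.
pose mx := (px + qx) / 2; pose my := (py + qy) / 2.
pose N := (x - mx) ^+ 2 + (y - my) ^+ 2.
pose e := (px - mx) ^+ 2 + (py - my) ^+ 2.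
have e0 : 0 < e.
  rewrite lt_neqAle addr_ge0 ?sqr_ge0 // andbT eq_sym paddr_eq0 ?sqr_ge0 //.
  rewrite !sqrf_eq0; apply: contraNN l0 => /andP[/eqP h1 /eqP h2]; rewrite /l.
  have -> : qx = px by move: h1; rewrite /mx => h1; lra.
  have -> : qy = py by move: h2; rewrite /my => h2; lra.
  by apply/eqP; ring.
have N0 : 0 <= N by rewrite addr_ge0 ?sqr_ge0.
pose d := e / (N + e).
have Ne : 0 < N + e by lra.
have d0 : 0 < d by rewrite divr_gt0.
pose M := (r px py)^-1 + (r qx qy)^-1.
have Mp : 1 <= r px py * M.
  rewrite mulrDr divff ?gt_eqF // lerDl mulr_ge0 ?invr_ge0 ?r0 //.
have Mq : 1 <= r qx qy * M.
  rewrite mulrDr divff ?gt_eqF // lerDr mulr_ge0 ?invr_ge0 ?r0 //.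
(* [A] equals [M] on the line through the two given points, and [t] is the slope at which it
   vanishes at [m - d ((x, y) - m)]. *)
pose t := M / (d * l).
pose A x y := t * (qy - py) * x + - t * (qx - px) * y +
    (M - t * (px * (qy - py) - py * (qx - px))).
have [cx [cy [k Hk]]] : disclike (fun x y => 1 <= r x y * A x y) by apply: Hr.
have Ap : A px py = M by rewrite /A; ring.
have Aq : A qx qy = M by rewrite /A; ring.
have Ay : A (mx - d * (x - mx)) (my - d * (y - my)) = 0.
  have -> : A (mx - d * (x - mx)) (my - d * (y - my)) = M - t * (d * l).
    by rewrite /A /l /mx /my; field.
  by rewrite /t divfK ?subrr // mulf_neq0 // gt_eqF.
have hp := Mp; rewrite -Ap in hp; move/Hk: hp => hp.
have hq := Mq; rewrite -Aq in hq; move/Hk: hq => hq.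
have hy : k < (mx - d * (x - mx) - cx) ^+ 2 + (my - d * (y - my) - cy) ^+ 2.
  by rewrite ltNge; apply/negP => /Hk; rewrite Ay mulr0 ler10.
have : 1 <= r x y * A x y.
  apply/Hk.
  have -> : x = mx + (x - mx) by ring.
  have -> : y = my + (y - my) by ring.
  apply: (@disc_opposite _ _ _ _ _ _ (px - mx) (py - my) _ _ d) => //.
  - by rewrite ![_ + (_ - _)]addrC !subrK.
  - have -> : mx - (px - mx) = qx by rewrite /mx; field.
    by have -> : my - (py - my) = qy by rewrite /my; field.
  - rewrite -/N -/e /d mulrAC ler_pdivrMr // ler_pM2l //; lra.
move=> h; rewrite lt_neqAle r0 andbT; apply/eqP => h0.
by move: h; rewrite -h0 mul0r ler10.
Qed.

Lemma disclike_midpoint (R : realFieldType) (P : R -> R -> Prop) (x y a b : R) :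
  disclike P -> P (x + a) (y + b) -> P (x - a) (y - b) -> P x y.
Proof.
move=> [cx [cy [k Hk]]] /Hk h1 /Hk h2; apply/Hk.
have := sqr_ge0 a; have := sqr_ge0 b; move: h1 h2.
have -> : (x + a - cx) ^+ 2 = (x - cx) ^+ 2 + a ^+ 2 + 2 * a * (x - cx) by ring.
have -> : (x - a - cx) ^+ 2 = (x - cx) ^+ 2 + a ^+ 2 - 2 * a * (x - cx) by ring.
have -> : (y + b - cy) ^+ 2 = (y - cy) ^+ 2 + b ^+ 2 + 2 * b * (y - cy) by ring.
have -> : (y - b - cy) ^+ 2 = (y - cy) ^+ 2 + b ^+ 2 - 2 * b * (y - cy) by ring.
lra.
Qed.

Section Sublevels.
Context (R : realFieldType) (g : R -> R -> R).
Hypothesis Hg : forall a b c, disclike (fun x y => g x y <= a * x + b * y + c).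

(* If the bound were attained at an interior point, midpoint convexity would force
   equality on a vertical segment around it, and the sublevel set for a
   tilted affine function would be an unbounded disc. *)
Lemma sublevel_boundary (a b c cx cy k px py : R) :
  (forall x y, g x y <= a * x + b * y + c <-> (x - cx) ^+ 2 + (y - cy) ^+ 2 <= k) ->
  g px py = a * px + b * py + c ->
  (px - cx) ^+ 2 + (py - cy) ^+ 2 = k.
Proof.
move=> Hk gp; apply/eqP; rewrite eq_le; apply/andP; split.
  by apply/Hk; rewrite gp.
rewrite leNgt; apply/negP => hlt.
set S := (px - cx) ^+ 2 + _ in hlt.
pose T : R := `|px - cx| + `|py - cy|.
have T0 : 0 <= T by rewrite addr_ge0.
pose e := (k - S) / (2 * T + 1 + (k - S)).
have den : 0 < 2 * T + 1 + (k - S) by lra.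
have e0 : 0 < e by rewrite divr_gt0 // subr_gt0.
have ek : e * (2 * T + e) <= k - S.
  have e1 : e <= 1 by rewrite ler_pdivrMr //; lra.
  have : e * (2 * T + 1 + (k - S)) = k - S by rewrite mulfVK // gt_eqF.
  have : e * e <= e * 1 by rewrite ler_pM2l.
  have : 0 <= e * (k - S) by rewrite mulr_ge0 //; lra.
  by rewrite !mulrDr; lra.
have D (s : R) : 0 <= s <= e -> forall p q : R, `|p| <= 1 -> `|q| <= 1 -> p * q = 0 ->
    g (px + p * s) (py + q * s) <= a * (px + p * s) + b * (py + q * s) + c.
  move=> /andP[s0 se] p q p1 q1 pq; apply/Hk.
  have -> : (px + p * s - cx) ^+ 2 + (py + q * s - cy) ^+ 2 =
    S + s * (2 * (p * (px - cx) + q * (py - cy)) + s * (p ^+ 2 + q ^+ 2)) by rewrite /S; ring.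
  have h1 : p * (px - cx) + q * (py - cy) <= T.
    apply: (le_trans (ler_norm _)); apply: (le_trans (ler_normD _ _)).
    by rewrite !normrM lerD // ler_piMl.
  have h2 : p ^+ 2 + q ^+ 2 <= 1.
    move: p1 q1; rewrite -(@ler_sqr _ `|p|) ?nnegrE // -(@ler_sqr _ `|q|) ?nnegrE //.
    rewrite !real_normK ?num_real // expr1n => p1 q1.
    by move/eqP: pq; rewrite mulf_eq0 => /orP[] /eqP ->; rewrite expr0n /= ?add0r ?addr0.
  have h3 : s * (p ^+ 2 + q ^+ 2) <= e.
    by apply: le_trans se; rewrite ler_piMr.
  have h4 : 2 * (p * (px - cx) + q * (py - cy)) + s * (p ^+ 2 + q ^+ 2) <= 2 * T + e by lra.
  have h5 := ler_wpM2l s0 h4.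
  have h6 : s * (2 * T + e) <= e * (2 * T + e) by apply: ler_wpM2r => //; lra.
  lra.
(* If [g] lay [t] below the bound at [py - s], tilt the bound so that it keeps its value at [py + s]
   and meets [g] at [py - s]; the midpoint would put [g] at least [t / 2] below the old bound at
   [p]. *)
have below (s : R) : 0 < s <= e -> a * px + b * (py - s) + c <= g px (py - s).
  move=> /andP[s0 se]; rewrite leNgt; apply/negP => h.
  set t := a * px + b * (py - s) + c - g px (py - s).
  have t0 : 0 < t by rewrite subr_gt0.
  have := @disclike_midpoint R _ px py 0 s (Hg a (b + t / (2 * s)) (c - t / 2 - t / (2 * s) * py)).
  rewrite addr0 subr0 => H.
  have : g px py <= a * px + (b + t / (2 * s)) * py + (c - t / 2 - t / (2 * s) * py).
    apply: H.
      have := D s; rewrite (ltW s0) se => /(_ isT 0 1).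
      rewrite normr0 normr1 !mul0r !mul1r addr0 => /(_ ler01 (lexx _) erefl) h1.
      apply: (le_trans h1); rewrite le_eqVlt; apply/orP; left; apply/eqP.
      by field; rewrite gt_eqF.
    rewrite le_eqVlt; apply/orP; left; apply/eqP.
    have -> : g px (py - s) = a * px + b * (py - s) + c - t by rewrite /t; ring.
    by field; rewrite gt_eqF.
  by rewrite gp; lra.
(* Adding [y - py] to the bound keeps it at height [py] and lowers it underneath: the new disc keeps
   the horizontal chord around [p] and misses the points just below [p]. Then [disc_opposite] puts
   every point at height [N >= e] above [p] inside it. *)
have [cx' [cy' [k' Hk']]] := Hg a (b + 1) (c - py).
have far N : e <= N -> (px - cx') ^+ 2 + (py + N - cy') ^+ 2 <= k'.
  move=> eN; have N0 : 0 < N by apply: lt_le_trans eN.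
  have D1 := D e; rewrite (ltW e0) lexx in D1.
  have := @disc_opposite R cx' cy' k' px py e 0 0 N (e ^+ 2 / N ^+ 2).
  rewrite !addr0 subr0 mulr0 subr0; apply.
  - apply/Hk'; have := D1 isT 1 0; rewrite normr0 normr1 mulr0 mul1r !mul0r addr0.
    by move=> /(_ (lexx _) ler01 erefl); lra.
  - apply/Hk'; have := D1 isT (-1) 0; rewrite normr0 normrN1 mulr0 mulN1r !mul0r addr0.
    by move=> /(_ (lexx _) ler01 erefl); lra.
  - rewrite ltNge; apply/negP => /Hk'.
    set s := e ^+ 2 / N ^+ 2 * N.
    have sE : s = e * (e / N) by rewrite /s; field; rewrite gt_eqF.
    have s0 : 0 < s by rewrite sE mulr_gt0 // divr_gt0.
    have se : s <= e by rewrite sE ler_piMr ?(ltW e0) // ler_pdivrMr // mul1r.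
    have := below s; rewrite s0 se => /(_ isT); lra.
  - by rewrite divr_gt0 // exprn_gt0.
  - rewrite expr0n /= !add0r addr0 mulfVK //; by rewrite expf_neq0 // gt_eqF.
have := far (e + `|k'| + 1 + `|py - cy'|).
set N := _ + `|py - cy'|.
have hN : `|k'| + 1 <= py + N - cy'.
  have := lerNnormlW (lexx `|py - cy'|); rewrite /N; lra.
have a0 : 0 <= `|k'| by [].
have a1 := ler_norm k'.
have a2 : 0 <= `|py - cy'| by [].
have hN2 : (`|k'| + 1) ^+ 2 <= (py + N - cy') ^+ 2.
  by rewrite ler_sqr ?nnegrE //; lra.
have := sqr_ge0 (px - cx').
have := sqr_ge0 `|k'|.
have : (`|k'| + 1) ^+ 2 = `|k'| ^+ 2 + 2 * `|k'| + 1 by ring.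
have eN : e <= N by rewrite /N; lra.
move=> h1 h2 h3 h4; move: (h4 eN) => h5.
clearbody N.
lra.
Qed.

(** The affine function interpolating [g] at the three points has a sublevel disc whose boundary
    circle passes through them by [sublevel_boundary]; the hypothesis on squared norms places the
    fourth point on the same circle. *)
Lemma concyclic_le (x1 y1 x2 y2 x3 y3 l1 l2 l3 : R) :
  (x2 - x1) * (y3 - y1) - (y2 - y1) * (x3 - x1) != 0 ->
  l1 + l2 + l3 = 1 ->
  (l1 * x1 + l2 * x2 + l3 * x3) ^+ 2 + (l1 * y1 + l2 * y2 + l3 * y3) ^+ 2 =
    l1 * (x1 ^+ 2 + y1 ^+ 2) + l2 * (x2 ^+ 2 + y2 ^+ 2) + l3 * (x3 ^+ 2 + y3 ^+ 2) ->
  g (l1 * x1 + l2 * x2 + l3 * x3) (l1 * y1 + l2 * y2 + l3 * y3) <=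
    l1 * g x1 y1 + l2 * g x2 y2 + l3 * g x3 y3.
Proof.
set D := (X in X != 0) => D0 hl hN.
pose u : R := g x2 y2 - g x1 y1; pose v := g x3 y3 - g x1 y1.
pose a : R := (u * (y3 - y1) - v * (y2 - y1)) / D.
pose b : R := ((x2 - x1) * v - (x3 - x1) * u) / D.
pose c : R := g x1 y1 - a * x1 - b * y1.
have e1 : g x1 y1 = a * x1 + b * y1 + c by rewrite /c; ring.
have e2 : g x2 y2 = a * x2 + b * y2 + c.
  have -> : a * x2 + b * y2 + c = a * (x2 - x1) + b * (y2 - y1) + g x1 y1.
    by rewrite /c; ring.
  by rewrite /a /b /u /v /D; field.
have e3 : g x3 y3 = a * x3 + b * y3 + c.
  have -> : a * x3 + b * y3 + c = a * (x3 - x1) + b * (y3 - y1) + g x1 y1.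
    by rewrite /c; ring.
  by rewrite /a /b /u /v /D; field.
have [cx [cy [k Hk]]] := Hg a b c.
have k1 := sublevel_boundary Hk e1.
have k2 := sublevel_boundary Hk e2.
have k3 := sublevel_boundary Hk e3.
have -> : l1 * g x1 y1 + l2 * g x2 y2 + l3 * g x3 y3 =
    a * (l1 * x1 + l2 * x2 + l3 * x3) + b * (l1 * y1 + l2 * y2 + l3 * y3) + c.
  move: e1 e2 e3; clearbody a b c => -> -> ->.
  have -> : l3 = 1 - l1 - l2 by lra.
  ring.
apply/Hk; rewrite le_eqVlt; apply/orP; left; apply/eqP.
set X := l1 * x1 + _ + _ in hN *; set Y := l1 * y1 + _ + _ in hN *.
have -> : (X - cx) ^+ 2 + (Y - cy) ^+ 2 =
  (X ^+ 2 + Y ^+ 2) - 2 * cx * X - 2 * cy * Y + (cx ^+ 2 + cy ^+ 2) * (l1 + l2 + l3).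
  by rewrite hl; ring.
rewrite hN; transitivity (l1 * ((x1 - cx) ^+ 2 + (y1 - cy) ^+ 2) +
    l2 * ((x2 - cx) ^+ 2 + (y2 - cy) ^+ 2) + l3 * ((x3 - cx) ^+ 2 + (y3 - cy) ^+ 2)).
  by rewrite /X /Y; ring.
by rewrite k1 k2 k3 -!mulrDl hl mul1r.
Qed.

(* One of the barycentric coordinates is positive; exchanging that vertex with
   the fourth point reverses the inequality. *)
Lemma concyclic_eq (x1 y1 x2 y2 x3 y3 x y l1 l2 l3 : R) :
  (x2 - x1) * (y3 - y1) - (y2 - y1) * (x3 - x1) != 0 ->
  l1 + l2 + l3 = 1 ->
  l1 * x1 + l2 * x2 + l3 * x3 = x -> l1 * y1 + l2 * y2 + l3 * y3 = y ->
  x ^+ 2 + y ^+ 2 =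
    l1 * (x1 ^+ 2 + y1 ^+ 2) + l2 * (x2 ^+ 2 + y2 ^+ 2) + l3 * (x3 ^+ 2 + y3 ^+ 2) ->
  g x y = l1 * g x1 y1 + l2 * g x2 y2 + l3 * g x3 y3.
Proof.
wlog l1_gt0 : x1 y1 x2 y2 x3 y3 l1 l2 l3 / 0 < l1 => [wl|].
  move=> D0 hl hx hy hN.
  have [l1p|l1n] := ltP 0 l1; first exact: wl.
  have [l2p|l2n] := ltP 0 l2.
    rewrite [in RHS](addrC (l1 * _)); apply: wl => //.
    - apply: contraNN D0 => /eqP D0; apply/eqP; lra.
    - lra.
    - lra.
    - lra.
    - lra.
  have l3p : 0 < l3 by lra.
  rewrite [in RHS]addrC addrA; apply: wl => //.
  - apply: contraNN D0 => /eqP D0; apply/eqP; lra.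
  - lra.
  - lra.
  - lra.
  - lra.
move=> D0 hl hx hy hN; apply/eqP; rewrite eq_le; apply/andP; split.
  by rewrite -hx -hy; apply: concyclic_le; rewrite // hx hy.
have := @concyclic_le x y x2 y2 x3 y3 (l1^-1) (- l2 / l1) (- l3 / l1).
have l10 : l1 != 0 by rewrite gt_eqF.
have E (s t p q : R) : l1 * s + l2 * p + l3 * q = t ->
  l1^-1 * t + - l2 / l1 * p + - l3 / l1 * q = s by move=> <-; field.
rewrite (E _ _ _ _ hx) (E _ _ _ _ hy) (E _ _ _ _ (esym hN)) => H.
have : g x1 y1 <= l1^-1 * g x y + - l2 / l1 * g x2 y2 + - l3 / l1 * g x3 y3.
  apply: H => //.
  - have -> : (x2 - x) * (y3 - y) - (y2 - y) * (x3 - x) =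
      l1 * ((x2 - x1) * (y3 - y1) - (y2 - y1) * (x3 - x1)).
      by rewrite -hx -hy (_ : l1 = 1 - l2 - l3); [ring|lra].
    by rewrite mulf_neq0.
  - by rewrite (_ : l1 = 1 - l2 - l3) in l10 *; [field|lra].
rewrite -(ler_pM2l l1_gt0) !mulrDr.
have -> : l1 * (- l2 / l1 * g x2 y2) = - (l2 * g x2 y2) by field.
have -> : l1 * (- l3 / l1 * g x3 y3) = - (l3 * g x3 y3) by field.
rewrite mulrA mulfV // mul1r; lra.
Qed.

(** [q] fits [g] at [0], [1], [-1] and [i]. Both obey the relation of [concyclic_eq], so agreement
    at three points of a circle spreads to all of it. *)
Lemma quadratic_of_disc_sublevels : exists al be ga de : R, 0 < al /\
  forall x y, g x y = al * (x ^+ 2 + y ^+ 2) + be * x + ga * y + de.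
Proof.
pose de : R := g 0 0.
pose al : R := (g 1 0 + g (-1) 0) / 2 - de.
pose be : R := (g 1 0 - g (-1) 0) / 2.
pose ga : R := g 0 1 - al - de.
pose q x y := al * (x ^+ 2 + y ^+ 2) + be * x + ga * y + de.
have q0 : g 0 0 = q 0 0 by rewrite /q /de; ring.
have q1 : g 1 0 = q 1 0 by rewrite /q /al /be; field.
have qN1 : g (-1) 0 = q (-1) 0 by rewrite /q /al /be; field.
have qi : g 0 1 = q 0 1 by rewrite /q /ga; ring.
pose P (X Y : R) := g X Y = q X Y.
have step x1 y1 x2 y2 x3 y3 x y l1 l2 l3 : P x1 y1 -> P x2 y2 -> P x3 y3 ->
  (x2 - x1) * (y3 - y1) - (y2 - y1) * (x3 - x1) != 0 ->
  l1 + l2 + l3 = 1 ->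
  l1 * x1 + l2 * x2 + l3 * x3 = x -> l1 * y1 + l2 * y2 + l3 * y3 = y ->
  x ^+ 2 + y ^+ 2 =
    l1 * (x1 ^+ 2 + y1 ^+ 2) + l2 * (x2 ^+ 2 + y2 ^+ 2) + l3 * (x3 ^+ 2 + y3 ^+ 2) ->
  P x y.
  rewrite /P => p1 p2 p3 D0 hl hx hy hN.
  rewrite (concyclic_eq D0 hl hx hy hN) p1 p2 p3 /q hN -hx -hy.
  by rewrite -[in RHS](mulr1 de) -hl; ring.
have circ x y : x ^+ 2 + y ^+ 2 = 1 -> P x y.
  move=> xy.
  apply: (@step 1 0 (-1) 0 0 1 x y ((1 + x - y) / 2) ((1 - x - y) / 2) y) => //.
  - by field.
  - by field.
  - by field.
  - by rewrite xy; field.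
(* A point [x] off the first axis lies on a circle through [0], [(e, 0)] and
   another point of the unit circle, found by inverting that circle into a line. *)
have off e x y : e ^+ 2 = 1 -> y != 0 -> x != e * (x ^+ 2 + y ^+ 2) -> P x y.
  move=> e1 y0; set N := _ + _ => xN.
  pose p : R := x - e * N.
  have p0 : p != 0 by rewrite subr_eq0.
  pose D := p ^+ 2 + y ^+ 2.
  have D0 : D != 0.
    by rewrite gt_eqF // ltr_wpDl ?sqr_ge0 // exprn_even_gt0.
  have e0 : e != 0 by apply: contra_eqN e1 => /eqP ->; rewrite expr0n eq_sym oner_eq0.
  (* After the inversion, [(u, v)] is the second point where the line through [(e, 0)] with
     direction [(p, y)] meets the unit circle. *)
  pose u : R := e - 2 * e * p ^+ 2 / D; pose v := - 2 * e * p * y / D.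
  have uv : u ^+ 2 + v ^+ 2 = 1.
    rewrite -e1 /u /v /D; move: D0; rewrite /D => D0; field; exact: D0.
  pose l2 := - e * D / (2 * p); pose l1 := N - l2.
  have DE : D = N * (1 - 2 * e * x + N).
    rewrite /D /p; have -> : (x - e * N) ^+ 2 = x ^+ 2 - 2 * e * x * N + e ^+ 2 * N ^+ 2 by ring.
    by rewrite e1 /N; ring.
  apply: (@step e 0 u v 0 0 x y l1 l2 (1 - l1 - l2)) => //.
  - by apply: circ; rewrite e1 expr0n addr0.
  - exact: circ.
  - have -> : (u - e) * (0 - 0) - (v - 0) * (0 - e) = e * v by ring.
    by rewrite /v; apply: mulf_neq0 => //; rewrite !mulf_neq0 ?invr_eq0.
  - by ring.
  - rewrite mulr0 addr0; transitivity (e * N + e ^+ 2 * p).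
      by rewrite /l1 /u /l2; field; rewrite p0 D0.
    by rewrite e1 /p; ring.
  - rewrite !mulr0 add0r addr0; transitivity (e ^+ 2 * y).
      by rewrite /v /l2; field; rewrite p0 D0.
    by rewrite e1 mul1r.
  - by rewrite -/N uv e1 expr0n /= /l1; ring.
have offaxis x y : y != 0 -> P x y.
  move=> y0; have N0 : 0 < x ^+ 2 + y ^+ 2.
    by rewrite ltr_wpDl ?sqr_ge0 // exprn_even_gt0.
  (* When [x = x ^+ 2 + y ^+ 2] that line is tangent to the unit circle at [1]; the base point [-1]
     then works because [x > 0]. *)
  have [xN|xN] := eqVneq x (x ^+ 2 + y ^+ 2); last first.
    by apply: (@off 1) => //; rewrite ?expr1n ?mul1r.
  apply: (@off (-1)) => //; first by rewrite sqrrN expr1n.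
  by rewrite mulN1r -subr_eq0 opprK {1}xN gt_eqF // addr_gt0.
have all x y : P x y.
  have [->|] := eqVneq y 0; last exact: offaxis.
  have [->|x0] := eqVneq x 0; first exact: q0.
  (* [(x, 0)] completes [(x, 1)], [(0, 0)], [(0, 1)] to a rectangle, whose vertices are
     concyclic. *)
  apply: (@step x 1 0 0 0 1 x 0 1 1 (-1)) => //; first by apply: offaxis; exact: oner_neq0.
  - by rewrite (_ : _ - _ = - x); [rewrite oppr_eq0|ring].
  - by ring.
  - by ring.
  - by ring.
  - by ring.
exists al, be, ga, de; split; last exact: all.
rewrite ltNge; apply/negP => al0.
have [cx [cy [k Hk]]] := Hg be ga de.
have /Hk : g (cx + `|k| + 1) cy <= be * (cx + `|k| + 1) + ga * cy + de.
  rewrite all /q; have := sqr_ge0 (cx + `|k| + 1); have := sqr_ge0 cy => h1 h2.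
  have : al * ((cx + `|k| + 1) ^+ 2 + cy ^+ 2) <= 0.
    by rewrite mulr_le0_ge0 // addr_ge0.
  by lra.
rewrite subrr expr0n addr0 (_ : _ - cx = `|k| + 1); last by ring.
have := ler_norm k; have : 0 <= `|k| by [].
have := sqr_ge0 `|k|; have : (`|k| + 1) ^+ 2 = `|k| ^+ 2 + 2 * `|k| + 1 by ring.
by move=> -> h1 h2 h3; lra.
Qed.

End Sublevels.

(** * The squared modulus *)

Local Open Scope complex_scope.

Section Csq.
Context {R : realType}.
Implicit Types (z w c : R[i]).

Lemma csqM z w : csq (z * w) = csq z * csq w.
Proof. by case: z w => [a b] [c d]; rewrite /csq /=; ring. Qed.

Lemma csq_ge0 z : 0 <= csq z.
Proof. by rewrite addr_ge0 ?sqr_ge0. Qed.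

Lemma csq_eq0 z : (csq z == 0) = (z == 0).
Proof.
case: z => a b; rewrite /csq /= paddr_eq0 ?sqr_ge0 // !sqrf_eq0.
by rewrite eq_complex /=.
Qed.

Lemma csq_gt0 z : (0 < csq z) = (z != 0).
Proof. by rewrite lt_neqAle csq_ge0 andbT eq_sym csq_eq0. Qed.

Lemma csq0 : csq (0 : R[i]) = 0.
Proof. by apply/eqP; rewrite csq_eq0. Qed.

Lemma csq1 : csq (1 : R[i]) = 1.
Proof. by rewrite /csq /= expr1n expr0n addr0. Qed.

Lemma csqN z : csq (- z) = csq z.
Proof. by case: z => a b; rewrite /csq /=; ring. Qed.

Lemma csqV z : csq z^-1 = (csq z)^-1.
Proof.
have [->|z0] := eqVneq z 0; first by rewrite invr0 csq0 invr0.
have c0 : csq z != 0 by rewrite csq_eq0.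
by apply: (mulfI c0); rewrite -csqM !divff // csq1.
Qed.

Lemma csqD z w : csq (z + w) = csq z + 2 * complex.Re (z * conjc w) + csq w.
Proof. by case: z w => [a b] [c d]; rewrite /csq /=; ring. Qed.

Lemma csqB z w : csq (z - w) = csq z - 2 * complex.Re (z * conjc w) + csq w.
Proof. by case: z w => [a b] [c d]; rewrite /csq /=; ring. Qed.

Lemma csq_conj z : csq (conjc z) = csq z.
Proof. by case: z => a b; rewrite /csq /=; ring. Qed.

Lemma Re_inv z : complex.Re z^-1 = complex.Re z / csq z.
Proof. by case: z => a b. Qed.

Lemma csq_real (a : R) : csq a%:C = a ^+ 2.
Proof. by rewrite /csq /= expr0n addr0. Qed.

Lemma Re_realM (a : R) z : complex.Re (a%:C * z) = a * complex.Re z.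
Proof. by case: z => x y /=; ring. Qed.

(** After multiplication by [csq w] the condition reads [s |w|^2 - 2 Re (w z) + 1 <= 0]; since [0]
    lies outside the disc, [s > 0] and completing the square gives a disc. *)
Lemma disc_inv z k : k < csq z -> exists m k', forall w,
  (w != 0 /\ csq (w^-1 - z) <= k) <-> csq (w - m) <= k'.
Proof.
move=> kz; pose s := csq z - k.
have s0 : 0 < s by rewrite subr_gt0.
exists (conjc z * (s^-1)%:C), (k / s ^+ 2) => w.
have key : w != 0 -> (csq (w^-1 - z) <= k) = (csq (w - conjc z * (s^-1)%:C) <= k / s ^+ 2).
  move=> w0; have cw : 0 < csq w by rewrite csq_gt0.
  rewrite -(ler_pM2l cw) -csqM mulrBr divff // csqB csq1 mul1r.
  have cj (x : R[i]) (a : R) : conjc (conjc x * a%:C) = a%:C * x.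
    by case: x => p q; apply/eqP; rewrite eq_complex /=; apply/andP; split; apply/eqP; ring.
  rewrite csqB (csqM (conjc z)) csq_conj csq_real cj mulrCA Re_realM.
  have -> : complex.Re (conjc (w * z)) = complex.Re (w * z) by case: (w * z).
  rewrite csqM -[RHS](ler_pM2l s0).
  set t := complex.Re (w * z).
  have -> : s * (csq w - 2 * (s^-1 * t) + csq z * s^-1 ^+ 2) =
     s * csq w - 2 * t + csq z / s by field; rewrite gt_eqF.
  have -> : s * (k / s ^+ 2) = csq z / s - 1.
    by rewrite /s; field; rewrite gt_eqF.
  by rewrite /s; apply/idP/idP; lra.
split=> [[w0 h]|h]; first by rewrite -key.
suff w0 : w != 0 by rewrite key.
apply: contraTN h => /eqP ->; rewrite sub0r csqN csqM csq_conj csq_real -ltNge.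
by rewrite exprVn ltr_pM2r // invr_gt0 exprn_gt0.
Qed.

Lemma disc_affine c d m k : d != 0 -> exists m' k', forall z,
  csq (c + d * z - m) <= k <-> csq (z - m') <= k'.
Proof.
move=> d0; exists ((m - c) / d), (k / csq d) => z.
have -> : c + d * z - m = d * (z - (m - c) / d) by field.
by rewrite csqM ler_pdivlMr ?csq_gt0 // mulrC.
Qed.

(* A disc in the closed right half-plane touching its boundary only at 0. *)
Lemma tangent_disc c k : csq (0 - c) <= k ->
  (forall z, csq (z - c) <= k -> z != 0 -> 0 < complex.Re z) ->
  exists r, 0 <= r /\ forall z, csq (z - c) <= k <-> csq z <= r * complex.Re z.
Proof.
case: c => a b; rewrite sub0r csqN => ck H.
pose s := Num.sqrt k.
have k0 : 0 <= k by apply: le_trans ck; exact: csq_ge0.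
have s0 : 0 <= s by exact: sqrtr_ge0.
have sk : s ^+ 2 = k by rewrite sqr_sqrtr.
have as_ : a <= s.
  apply: (le_trans (ler_norm a)); rewrite -ler_sqr ?nnegrE // sk real_normK ?num_real //.
  by apply: le_trans ck; rewrite /csq /= lerDl sqr_ge0.
(* The leftmost point of the disc has nonpositive real part, so it must be the origin. *)
have /eqP : Complex (a - s) b == 0.
  apply/negPn/negP => n0; have : 0 < complex.Re (Complex (a - s) b).
    by apply: H => //; rewrite /csq /= subrr expr0n addr0 -sk addrAC subrr sub0r sqrrN.
  by rewrite /= => h; lra.
case=> /eqP; rewrite subr_eq0 => /eqP ea eb.
exists (2 * a); split; first by rewrite mulr_ge0 // ea.
case=> x y; rewrite eb -sk -ea /csq /=.
by split=> h; lra.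
Qed.

End Csq.

(** * Sections through a farthest point *)

Section Projective.
Context {R : realType} {V : lmodType R[i]} (K : V -> Prop) (l : {scalar V}) (u : V).
Hypothesis K0 : K 0.
Hypothesis Kl : forall y, K y -> y != 0 -> 0 < complex.Re (l y).
Hypothesis Kline : forall a v, v != 0 ->
  exists c k, forall z, K (a + z *: v) <-> csq (z - c) <= k.
Hypothesis lu : l u = 1.

(** Projection along [u] onto the affine hyperplane [l = 1], so that functions on the hyperplane can
    be handled as functions on all of [V]. *)
Definition chart (v : V) : V := u + (v - l v *: u).

Lemma form_proj v : l (v - l v *: u) = 0.
Proof. by rewrite linearB linearZ /= lu mulr1 subrr. Qed.

Lemma form_chart v : l (chart v) = 1.
Proof. by rewrite linearD /= form_proj lu addr0. Qed.

Lemma chart_line a b z :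
  chart (a + z *: b) = chart a + z *: (b - l b *: u).
Proof.
rewrite /chart [l (a + _)]linearD [l (z *: b)]linearZ /= scalerDl scalerBr scalerA opprD.
by rewrite -!addrA; congr (_ + (_ + _)); rewrite addrCA.
Qed.

Lemma scaled_chart_section w : l w = 1 ->
  exists r, 0 <= r /\ forall z, K (z *: w) <-> csq z <= r * complex.Re z.
Proof.
move=> lw; have w0 : w != 0.
  by apply: contra_eqN lw => /eqP ->; rewrite linear0 eq_sym oner_eq0.
have [c [k Hk]] := Kline 0 w0.
have Hk' z : K (z *: w) <-> csq (z - c) <= k by rewrite -Hk add0r.
have [|z /Hk' Kz z0|r [r0 Hr]] := @tangent_disc R c k.
- by apply/Hk'; rewrite scale0r.
- have := Kl Kz; rewrite linearZ /= lw mulr1; apply.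
  by rewrite scaler_eq0 negb_or z0.
by exists r; split=> // z; rewrite Hk' Hr.
Qed.

Section Rho.
Variable r : V -> R.
Hypothesis r_ge0 : forall v, 0 <= r v.
Hypothesis Kr : forall v z, K (z *: chart v) <-> csq z <= r v * complex.Re z.

(** The inversion [z = 1 / w] turns a disc of diameter [r v] through [0] into a half-plane. The
    value [w = 0] is excluded by hand because [0^-1 = 0] and [K 0] holds. *)
Lemma one_le_rho v w :
  1 <= r v * complex.Re w <-> w != 0 /\ K (w^-1 *: chart v).
Proof.
rewrite Kr Re_inv csqV; have [->|w0] := eqVneq w 0.
  by rewrite mulr0 lt_geF //; split=> // -[].
have cw : 0 < csq w by rewrite csq_gt0.
have -> : (1 <= r v * complex.Re w) = ((csq w)^-1 <= r v * (complex.Re w / csq w)).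
  by rewrite -[RHS](ler_pM2l cw) divff ?gt_eqF // mulrCA [csq w * _]mulrC divfK ?gt_eqF.
by split=> // -[].
Qed.

(** With [w = c + d * z] and [d != 0], the point [w^-1 *: chart (a + z *: b)] is [f + w^-1 *: e]: it
    runs over a complex line with parameter [1 / w]. The section there is a disc missing the
    parameter [0], as [l f = 0], and inversion makes it a disc in [w], hence in [z]. For [d = 0] and
    [c != 0] the point moves along a complex line with parameter [z]. *)
Lemma rho_line_disc a b c d : b - l b *: u != 0 ->
  exists m k, forall z, 1 <= r (a + z *: b) * complex.Re (c + d * z) <-> csq (z - m) <= k.
Proof.
set b' := b - _ => b0; have lb : l b' = 0 by exact: form_proj.
have cl z : chart (a + z *: b) = chart a + z *: b' by exact: chart_line.
clearbody b'.
have [->|d0] := eqVneq d 0.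
  have [->|c0] := eqVneq c 0.
    exists 0, (-1) => z; rewrite mul0r addr0 mulr0.
    by split=> h; [move: h; rewrite ler10 | have := csq_ge0 (z - 0); lra].
  have cb0 : c^-1 *: b' != 0 by rewrite scaler_eq0 negb_or invr_eq0 c0.
  have [m [k Hk]] := Kline (c^-1 *: chart a) cb0.
  exists m, k => z; rewrite -Hk mul0r addr0 one_le_rho cl scalerDr !scalerA.
  by rewrite [c^-1 * z]mulrC; split=> // -[].
pose f := d^-1 *: b'; pose e := chart a - (c / d) *: b'.
have le1 : l e = 1 by rewrite linearB linearZ /= lb mulr0 subr0 form_chart.
have e0 : e != 0 by apply: contra_eqN le1 => /eqP ->; rewrite linear0 eq_sym oner_eq0.
have [m [k Hk]] := Kline f e0.
have km : k < csq m.
  rewrite ltNge; apply/negP => h; have /Kl : K f.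
    by rewrite -[f]addr0 -(scale0r e); apply/Hk; rewrite sub0r csqN.
  rewrite linearZ /= lb mulr0 ltxx scaler_eq0 negb_or invr_eq0 d0 b0.
  by move=> /(_ isT).
have [m' [k' Hk']] := disc_inv km.
have [m2 [k2 Hk2]] := disc_affine c m' k' d0.
exists m2, k2 => z; rewrite -Hk2 -Hk' one_le_rho -Hk.
set w := c + d * z; have [->|w0] := eqVneq w 0; first by split=> -[].
suff -> : w^-1 *: chart (a + z *: b) = f + w^-1 *: e by [].
rewrite cl /e /f scalerDr scalerBr !scalerA addrCA; congr (_ + _).
rewrite -scaleNr -scalerDl; congr (_ *: _).
have -> : z = (w - c) / d by rewrite /w; field.
by field; rewrite w0 d0.
Qed.

Lemma rho_line_disclike a b : b - l b *: u != 0 ->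
  forall al be ga, disclike (fun x y => 1 <= r (a + Complex x y *: b) * (al * x + be * y + ga)).
Proof.
move=> b0 al be ga.
(* [al x + be y + ga] is the real part of [ga + (al - i be) (x + i y)]. *)
have [[mx my] [k Hk]] := rho_line_disc a (Complex ga 0) (Complex al (- be)) b0.
exists mx, my, k => x y; have := Hk (Complex x y).
rewrite /csq /= => <-; have -> // : ga + (al * x - - be * y) = al * x + be * y + ga by ring.
Qed.

(** On the complex line joining the chart image of the interior point [y0] to [v], [r] is positive
    near that image, and [positive_off_line] carries positivity to [v]. *)
Lemma rho_gt0 y0 : y0 != 0 ->
  (forall w, exists e, 0 < e /\ forall z, csq z <= e -> K (y0 + z *: w)) ->
  forall v, 0 < r v.
Proof.
move=> y00 Kint v.
have Ky0 : K y0.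
  have [e [e0 He]] := Kint 0; rewrite -[y0]addr0 -(scaler0 V 0); apply: He.
  by rewrite csq0 ltW.
have ly0 : l y0 != 0.
  by have := Kl Ky0 y00; apply: contraTneq => ->; rewrite ltxx.
pose v0 := (l y0)^-1 *: y0.
have lv0 : l v0 = 1 by rewrite linearZ /= mulVf.
have chart0 : chart v0 = v0 by rewrite /chart lv0 scale1r addrCA subrr addr0.
have pos w : K (l y0 *: chart w) -> 0 < r w.
  rewrite Kr => h; rewrite lt_neqAle r_ge0 andbT eq_sym; apply/eqP => r0.
  by move: h; rewrite r0 mul0r leNgt csq_gt0 ly0.
have [b0|b0] := eqVneq (v - v0 - l (v - v0) *: u) 0.
  apply: pos; have -> : v = v0 + 1 *: (v - v0) by rewrite scale1r addrC subrK.
  by rewrite chart_line b0 scaler0 addr0 chart0 /v0 scalerA mulfV // scale1r.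
have [e [e0 He]] := Kint (l y0 *: (v - v0 - l (v - v0) *: u)).
have near z : csq z <= e -> 0 < r (v0 + z *: (v - v0)).
  move=> /He h; apply: pos; rewrite chart_line chart0 scalerDr {1}/v0 !scalerA.
  by move: h; rewrite scalerA mulfV // scale1r [z * _]mulrC.
pose s := Num.sqrt e.
have s0 : 0 < s by rewrite sqrtr_gt0.
have := @positive_off_line R (fun x y => r (v0 + Complex x y *: (v - v0))) 0 s 0 0 1 0.
rewrite /= (_ : v0 + Complex 1 0 *: (v - v0) = v); last first.
  by rewrite (_ : Complex 1 0 = 1) // scale1r addrC subrK.
apply.
- by move=> x y; exact: r_ge0.
- exact: rho_line_disclike.
- by apply: near; rewrite /csq /= expr0n add0r sqr_sqrtr // ltW.
- by apply: near; rewrite /csq /= expr0n addr0 ltW.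
- by rewrite !subr0 sub0r mul1r mulr0 subr0 oppr_eq0 gt_eqF.
Qed.

End Rho.

(** Take [Q = 1 / r]: the discs [1 <= r A] become sublevel sets [Q <= A], to which
    [quadratic_of_disc_sublevels] applies. *)
Lemma chart_gauge y0 : y0 != 0 ->
  (forall w, exists e, 0 < e /\ forall z, csq z <= e -> K (y0 + z *: w)) ->
  exists Q : V -> R, [/\ forall v, 0 < Q v,
    forall v, Q v = Q (v - l v *: u),
    forall v z, K (z *: chart v) <-> Q v * csq z <= complex.Re z &
    forall a b, b - l b *: u != 0 -> exists al be ga de, 0 < al /\
      forall x y, Q (a + Complex x y *: b) =
        al * (x ^+ 2 + y ^+ 2) + be * x + ga * y + de].
Proof.
move=> y00 Kint.
have /choice[rho Hrho] : forall w, exists r, l w = 1 ->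
    0 <= r /\ forall z, K (z *: w) <-> csq z <= r * complex.Re z.
  move=> w; have [lw|lw] := eqVneq (l w) 1.
    by have [r Hr] := scaled_chart_section lw; exists r.
  by exists 0 => h; rewrite h eqxx in lw.
pose r v := rho (chart v).
have r_ge0 v : 0 <= r v by have [] := Hrho _ (form_chart v).
have Kr v z : K (z *: chart v) <-> csq z <= r v * complex.Re z.
  by have [_] := Hrho _ (form_chart v); apply.
have r_gt0 := rho_gt0 r_ge0 Kr y00 Kint.
exists (fun v => (r v)^-1); split.
- by move=> v; rewrite invr_gt0.
- by move=> v; rewrite /r /chart form_proj scale0r subr0.
- by move=> v z; rewrite Kr -(ler_pM2l (_ : 0 < (r v)^-1)) ?invr_gt0 // mulKf // gt_eqF.
move=> a b b0; apply: (@quadratic_of_disc_sublevels R (fun x y => (r (a + Complex x y *: b))^-1)).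
move=> al be ga; have [cx [cy [k Hk]]] := rho_line_disclike Kr a b0 al be ga.
exists cx, cy, k => x y; rewrite -Hk.
by rewrite /= -[(r _)^-1 <= _](ler_pM2l (r_gt0 (a + Complex x y *: b))) divff // gt_eqF.
Qed.

End Projective.

(** * Functions quadratic on complex lines *)

Section QuadraticOnLines.
Context {R : realType} {V : lmodType R[i]} (Q : V -> R).
Hypothesis HQ : forall a b, exists al be ga de, forall x y,
  Q (a + Complex x y *: b) = al * (x ^+ 2 + y ^+ 2) + be * x + ga * y + de.

(** Together with the constant [Q 0], these split [Q] into a part that scales by [csq z] and a
    real-linear part. *)
Definition even_part v := (Q v + Q (- v)) / 2 - Q 0.
Definition odd_part v := (Q v - Q (- v)) / 2.
Local Notation E := even_part.
Local Notation O := odd_part.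

Lemma even_odd_part v : Q v = E v + O v + Q 0.
Proof. by rewrite /E /O; field. Qed.

Lemma quadratic_real_line a b : exists al be, forall t : R,
  Q (a + t%:C *: b) = al * t ^+ 2 + be * t + Q a.
Proof.
have [al [be [ga [de H]]]] := HQ a b; exists al, be => t.
have := H t 0; have := H 0 0; rewrite (_ : Complex 0 0 = 0) // scale0r addr0 => -> ->.
by ring.
Qed.

Lemma even_odd_real_line a b : exists al be ga de, forall t : R,
  E (a + t%:C *: b) = al * t ^+ 2 + be * t + E a /\
  O (a + t%:C *: b) = ga * t ^+ 2 + de * t + O a.
Proof.
have [al [be H]] := quadratic_real_line a b.
have [al' [be' H']] := quadratic_real_line (- a) (- b).
exists ((al + al') / 2), ((be + be') / 2), ((al - al') / 2), ((be - be') / 2) => t.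
by rewrite /E /O opprD -scalerN H H'; split; field.
Qed.

Lemma even_partZ z v : E (z *: v) = csq z * E v.
Proof.
have [al [be [ga [de H]]]] := HQ 0 v.
have H' x y : Q (Complex x y *: v) = al * (x ^+ 2 + y ^+ 2) + be * x + ga * y + de.
  by rewrite -H add0r.
have H1 : Q v = al + be + de.
  by have := H' 1 0; rewrite (_ : Complex 1 0 = 1) // scale1r => ->; ring.
have HN1 : Q (- v) = al - be + de.
  have := H' (-1) 0; rewrite (_ : Complex (-1) 0 = -1) ?scaleN1r => [->|]; first by ring.
  by apply/eqP; rewrite eq_complex /= oppr0 !eqxx.
have H0 : Q 0 = de.
  by have := H' 0 0; rewrite (_ : Complex 0 0 = 0) // scale0r => ->; ring.
case: z => x y; rewrite /E -scaleNr (_ : - Complex x y = Complex (- x) (- y)) //.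
by rewrite !H' H1 HN1 H0 /csq /=; field.
Qed.

Lemma odd_partZ (t : R) v : O (t%:C *: v) = t * O v.
Proof.
have [al [be H]] := quadratic_real_line 0 v.
have H' s : Q (s%:C *: v) = al * s ^+ 2 + be * s + Q 0 by rewrite -H add0r.
have H1 : Q v = al + be + Q 0.
  by have := H' 1; rewrite scale1r => ->; ring.
have HN1 : Q (- v) = al - be + Q 0.
  by have := H' (-1); rewrite rmorphN1 scaleN1r => ->; ring.
by rewrite /O -scaleNr -rmorphN !H' H1 HN1; field.
Qed.

(* Compare the expansion along [a + t b] with the one along [t^-1 a + b]. *)
Lemma odd_part_linear a b (t : R) : O (a + t%:C *: b) = O a + t * O b.
Proof.
have [? [? [c2 [c1 H]]]] := even_odd_real_line a b.
have [? [? [d2 [d1 H']]]] := even_odd_real_line b a.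
have key s : s != 0 -> d2 * s ^+ 3 + d1 * s ^+ 2 + O b * s = c2 + c1 * s + O a * s ^+ 2.
  move=> s0; have [_ h1] := H s^-1; have [_ h2] := H' s.
  have : O (b + s%:C *: a) = s * O (a + s^-1%:C *: b).
    rewrite -odd_partZ scalerDr scalerA -rmorphM /= mulfV // scale1r.
    by rewrite [b + _]addrC.
  rewrite h1 h2 => h3.
  have -> : d2 * s ^+ 3 + d1 * s ^+ 2 + O b * s = (d2 * s ^+ 2 + d1 * s + O b) * s by ring.
  by rewrite h3; field.
have k1 := key 1 (oner_neq0 _).
have k2 := key 2 ltac:(by rewrite pnatr_eq0).
have k3 := key (-1) ltac:(by rewrite oppr_eq0 oner_eq0).
have k4 := key (-2) ltac:(by rewrite oppr_eq0 pnatr_eq0).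
have c20 : c2 = 0 by lra.
have c1E : c1 = O b by lra.
by have [_ ->] := H t; rewrite c20 c1E; ring.
Qed.

(** Homogeneity relates the expansion along [a + t b] to the one along [b + s a] with [s = 1 / t];
    comparing them identifies the leading coefficient as [E b]. *)
Lemma even_part_line a b : exists c, forall t : R,
  E (a + t%:C *: b) = E a + t * c + t ^+ 2 * E b.
Proof.
have [c2 [c1 [? [? H]]]] := even_odd_real_line a b.
have [d2 [d1 [? [? H']]]] := even_odd_real_line b a.
have key s : s != 0 -> d2 * s ^+ 2 + d1 * s + E b = c2 + c1 * s + E a * s ^+ 2.
  move=> s0; have [h1 _] := H s^-1; have [h2 _] := H' s.
  have : E (b + s%:C *: a) = s ^+ 2 * E (a + s^-1%:C *: b).
    rewrite -csq_real -even_partZ scalerDr scalerA -rmorphM /= mulfV // scale1r.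
    by rewrite [b + _]addrC.
  by rewrite h1 h2 => ->; field.
have k1 := key 1 (oner_neq0 _).
have k2 := key 2 ltac:(by rewrite pnatr_eq0).
have k3 := key (-1) ltac:(by rewrite oppr_eq0 oner_eq0).
have c2E : c2 = E b by lra.
by exists c1 => t; have [-> _] := H t; rewrite c2E; ring.
Qed.

Variable l : {scalar V}.

(* Extends [|l y|^2 * Q (y / l y)] across the hyperplane [l = 0]. *)
Definition homogenization y := E y + O (conjc (l y) *: y) + Q 0 * csq (l y).
Local Notation F := homogenization.

(** [(l y)^-1] is [conjc (l y)] times a real factor, and the real factor can be pulled out of the
    odd part. *)
Lemma homogenizationE y : l y != 0 -> F y = csq (l y) * Q ((l y)^-1 *: y).
Proof.
move=> ly0; have c0 : csq (l y) != 0 by rewrite csq_eq0.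
have -> : (l y)^-1 *: y = (csq (l y))^-1%:C *: (conjc (l y) *: y).
  rewrite scalerA; congr (_ *: _); apply: (mulfI ly0); rewrite mulfV //.
  case: (l y) c0 => p q; rewrite /csq /= => c0; apply/eqP; rewrite eq_complex /=.
  by apply/andP; split; apply/eqP; field.
rewrite even_odd_part even_partZ odd_partZ even_partZ csq_conj csq_real /F.
by field.
Qed.

(** The factor [conjc (l y)] cancels the phase of [z] in the odd term. *)
Lemma homogenizationZ z y : F (z *: y) = csq z * F y.
Proof.
rewrite /F even_partZ [l _]linearZ /= csqM scalerA.
have -> : conjc (z * l y) * z = (csq z)%:C * conjc (l y).
  by case: z (l y) => [a b] [c d]; apply/eqP; rewrite eq_complex /csq /=; apply/andP;
    split; apply/eqP; ring.
by rewrite -scalerA odd_partZ; ring.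
Qed.

Lemma homogenization_line a b : exists c, forall t : R,
  F (a + t%:C *: b) = F a + t * c + t ^+ 2 * F b.
Proof.
have [c Hc] := even_part_line a b.
exists (c + O (conjc (l a) *: b) + O (conjc (l b) *: a)
  + 2 * Q 0 * complex.Re (l a * conjc (l b))) => t.
rewrite /F Hc [l (_ + _)]linearD [l (_ *: _)]linearZ /=.
have -> : conjc (l a + t%:C * l b) *: (a + t%:C *: b) =
   conjc (l a) *: a + t%:C *: (conjc (l a) *: b + 1%:C *: (conjc (l b) *: a)
     + t%:C *: (conjc (l b) *: b)).
  have -> : conjc (l a + t%:C * l b) = conjc (l a) + t%:C * conjc (l b).
    by case: (l a) (l b) => [p q] [r s]; apply/eqP; rewrite eq_complex /=; apply/andP;
      split; apply/eqP; ring.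
  rewrite scale1r scalerDl !scalerDr !scalerA [conjc (l a) * t%:C]mulrC.
  by rewrite [t%:C * conjc (l b) * t%:C]mulrC -!addrA mulrA.
rewrite !odd_part_linear csqD csqM csq_real.
have -> : complex.Re (l a * conjc (t%:C * l b)) = t * complex.Re (l a * conjc (l b)).
  by case: (l a) (l b) => [p q] [r s] /=; ring.
by ring.
Qed.

End QuadraticOnLines.

(** * Hermitian forms *)

Local Open Scope sesquilinear_scope.

Section HermitianForm.
Context {R : realType} {V : lmodType R[i]} (F : V -> R).
Hypothesis F_line : forall a b, exists c, forall t : R,
  F (a + t%:C *: b) = F a + t * c + t ^+ 2 * F b.
Hypothesis FZ : forall z y, F (z *: y) = csq z * F y.

Definition polar x y := F (x + y) - F x - F y.
Local Notation B := polar.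

Lemma polar_line a b (t : R) : F (a + t%:C *: b) = F a + t * B a b + t ^+ 2 * F b.
Proof.
have [c H] := F_line a b; rewrite H; congr (_ + _ * _ + _).
by have := H 1; rewrite scale1r /polar => ->; ring.
Qed.

Lemma polarC x y : B x y = B y x.
Proof. by rewrite /polar [y + x]addrC; ring. Qed.

Lemma form_sub x y : F (x - y) = F x - B x y + F y.
Proof. by have := polar_line x y (-1); rewrite rmorphN1 scaleN1r => ->; ring. Qed.

Lemma form_add x y : F (x + y) = F x + B x y + F y.
Proof. by rewrite /polar; ring. Qed.

Lemma parallelogram x y : F (x + y) + F (x - y) = 2 * F x + 2 * F y.
Proof. by rewrite form_sub form_add; ring. Qed.

(** Jordan-von Neumann argument: the parallelogram law at four pairs forces additivity. *)
Lemma polarDl x y z : B (x + y) z = B x z + B y z.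
Proof.
have h1 := parallelogram (x + y) z.
have h2 := parallelogram x (y - z).
have h3 := parallelogram (x + z) y.
have h4 := parallelogram y z.
have e2 : x + (y - z) = x + y - z by rewrite addrA.
have e3 : x - (y - z) = x + z - y by rewrite opprB addrA.
have e4 : x + z + y = x + y + z by rewrite addrAC.
by rewrite e2 e3 in h2; rewrite e4 in h3; rewrite /polar; lra.
Qed.

Lemma polarZr x y (t : R) : B x (t%:C *: y) = t * B x y.
Proof. by rewrite {1}/polar polar_line FZ csq_real; ring. Qed.

Lemma polarZZ z x y : B (z *: x) (z *: y) = csq z * B x y.
Proof. by rewrite /polar -scalerDr !FZ; ring. Qed.

(** The imaginary part is forced by linearity in [y], which requires
    [Re (S x (i y)) = - Im (S x y)]. *)
Definition hermitian_polar x y : R[i] :=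
  Complex (B x y / 2) (- B x ('i *: y) / 2).
Local Notation S := hermitian_polar.

Lemma hermitian_polarDl x y z : S (x + y) z = S x z + S y z.
Proof.
rewrite /S !polarDl; apply/eqP; rewrite eq_complex /=.
by apply/andP; split; apply/eqP; ring.
Qed.

Lemma csq_i : csq ('i : R[i]) = 1.
Proof. by rewrite /csq /= expr0n expr1n add0r. Qed.

Lemma scale_ii y : 'i *: ('i *: y) = - y :> V.
Proof. by rewrite scalerA -expr2 sqr_i scaleN1r. Qed.

Lemma polarNr x y : B x (- y) = - B x y.
Proof. by have := polarZr x y (-1); rewrite rmorphN1 scaleN1r mulN1r. Qed.

(** Multiplication by ['i] preserves the polar form and squares to [-1], hence is skew for it. *)
Lemma polar_iC x y : B y ('i *: x) = - B x ('i *: y).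
Proof. by rewrite polarC -[LHS]mul1r -csq_i -polarZZ scale_ii polarC polarNr polarC. Qed.

Lemma hermitian_polarC x y : S y x = conjc (S x y).
Proof. by rewrite /S polarC polar_iC /=; congr Complex; ring. Qed.

Lemma hermitian_polarDr x y z : S x (y + z) = S x y + S x z.
Proof. by rewrite 3!(hermitian_polarC _ x) hermitian_polarDl; exact: rmorphD. Qed.

Lemma hermitian_polarZr z x y : S x (z *: y) = z * S x y.
Proof.
have real (t : R) w : S x (t%:C *: w) = t%:C * S x w.
  rewrite /S scalerA [_ * t%:C]mulrC -scalerA !polarZr.
  by apply/eqP; rewrite eq_complex /=; apply/andP; split; apply/eqP; ring.
have imag w : S x ('i *: w) = 'i * S x w.
  rewrite /S scale_ii polarNr.
  by apply/eqP; rewrite eq_complex /=; apply/andP; split; apply/eqP; ring.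
case: z => a b; have -> : Complex a b = a%:C + b%:C * 'i.
  by apply/eqP; rewrite eq_complex /=; apply/andP; split; apply/eqP; ring.
by rewrite scalerDl -scalerA hermitian_polarDr !real imag mulrDl mulrA.
Qed.

Lemma hermitian_polarZl z x y : S (z *: x) y = conjc z * S x y.
Proof. by rewrite hermitian_polarC hermitian_polarZr (hermitian_polarC y x); exact: rmorphM. Qed.

Lemma hermitian_polar_diag x : S x x = (F x)%:C.
Proof.
have i0 : B x ('i *: x) = 0 by have := polar_iC x x; lra.
rewrite /S i0 /polar -[x + x]scale1r scalerDr -scalerDl FZ.
rewrite (_ : csq (1 + 1) = 4); last by rewrite /csq /=; ring.
by congr Complex; field.
Qed.

End HermitianForm.

(** * Diagonalization of Hermitian forms *)

Section HermitianMatrix.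
Context {R : realType} {n : nat} (F : 'cV[R[i]]_n -> R).
Hypothesis F_line : forall a b, exists c, forall t : R,
  F (a + t%:C *: b) = F a + t * c + t ^+ 2 * F b.
Hypothesis FZ : forall z y, F (z *: y) = csq z * F y.
Local Notation S := (hermitian_polar F).

Lemma conjC_conjc (z : R[i]) : Num.conj z = conjc z.
Proof. by []. Qed.

(** Spectral theorem for the Gram matrix [M] of [S] in the standard basis; [M] is Hermitian, so its
    eigenvalues are real. *)
Lemma hermitian_form_diag : exists (U : 'M[R[i]]_n) (d : 'I_n -> R),
  U \in unitmx /\ forall y, F y = \sum_i d i * csq ((U *m y) i 0).
Proof.
pose e i : 'cV[R[i]]_n := delta_mx i 0.
pose M := \matrix_(i, j) S (e i) (e j).
have Mherm : M \is hermsymmx.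
  apply/is_hermitianmxP; rewrite expr0 scale1r; apply/matrixP => i j.
  by rewrite !mxE conjC_conjc (hermitian_polarC F_line FZ).
have FM y : (y ^t* *m M *m y) 0 0 = (F y)%:C.
  have S0l z : S 0 z = 0 by rewrite -(scale0r z) (hermitian_polarZl F_line FZ) conjc0 mul0r.
  have S0r z : S z 0 = 0 by rewrite -(scale0r z) (hermitian_polarZr F_line FZ) mul0r.
  have yE : y = \sum_i y i 0 *: e i.
    by rewrite {1}[y]matrix_sum_delta; apply: eq_bigr => i _; rewrite big_ord1.
  rewrite -(hermitian_polar_diag F_line FZ) {4}yE.
  rewrite (big_morph (S y) (hermitian_polarDr F_line FZ y) (S0r y)) mxE.
  apply: eq_bigr => k _; rewrite (hermitian_polarZr F_line FZ) mulrC; congr (_ * _).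
  rewrite {2}yE (big_morph (S^~ (e k)) (fun x y => hermitian_polarDl F_line x y (e k)) (S0l _)).
  rewrite mxE; apply: eq_bigr => j _.
  by rewrite !mxE (hermitian_polarZl F_line FZ).
have /orthomx_spectralP ME := hermitian_normalmx Mherm.
have dreal := hermitian_spectral_diag_real Mherm.
pose P := spectralmx M; pose d := spectral_diag M.
exists P, (fun i => complex.Re (d 0 i)); split; first exact: spectral_unit.
move=> y; apply: complexI; rewrite -FM {1}ME invmx_unitary ?spectral_unitarymx //.
rewrite -/P -/d.
have -> : y ^t* *m (P ^t* *m diag_mx d *m P) *m y = (P *m y) ^t* *m diag_mx d *m (P *m y).
  by rewrite trmx_mul map_mxM !mulmxA.
rewrite mxE rmorph_sum; apply: eq_bigr => i _.
rewrite mul_mx_diag !mxE conjC_conjc.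
have -> : d 0 i = (complex.Re (d 0 i))%:C by rewrite RRe_real //; move/mxOverP: dreal; apply.
rewrite mulrAC mulrC; case: (\sum_j _) => a b.
by apply/eqP; rewrite eq_complex /csq /=; apply/andP; split; apply/eqP; ring.
Qed.

End HermitianMatrix.

(** * Topology of complex affine space *)

Section Topology.
Context {R : realType}.

Lemma normc_lt (z : R[i]) (e : R) : 0 <= e -> (`|z| < e%:C) = (csq z < e ^+ 2).
Proof.
move=> e0; rewrite -(@ltr_pXn2r _ 2) ?nnegrE ?normr_ge0 ?ler0c //.
by rewrite -add_Re2_Im2 -rmorphXn ltcR.
Qed.

Lemma Re_continuous : continuous (@complex.Re R).
Proof.
move=> z A /nbhs_ballP[e e0 eA]; apply/nbhs_ballP; exists e%:C => /=; first by rewrite ltcR.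
move=> w; rewrite /ball /= normc_lt ?ltW // => h; apply: eA; rewrite /ball /=.
rewrite -(@ltr_pXn2r _ 2) ?nnegrE ?normr_ge0 ?ltW // real_normK ?num_real //.
apply: le_lt_trans h; case: z w => [a b] [c d]; rewrite /csq /=.
by rewrite lerDl sqr_ge0.
Qed.

Lemma Im_continuous : continuous (@complex.Im R).
Proof.
move=> z A /nbhs_ballP[e e0 eA]; apply/nbhs_ballP; exists e%:C => /=; first by rewrite ltcR.
move=> w; rewrite /ball /= normc_lt ?ltW // => h; apply: eA; rewrite /ball /=.
rewrite -(@ltr_pXn2r _ 2) ?nnegrE ?normr_ge0 ?ltW // real_normK ?num_real //.
apply: le_lt_trans h; case: z w => [a b] [c d]; rewrite /csq /=.
by rewrite lerDr sqr_ge0.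
Qed.

Lemma csq_continuous : continuous (@csq R).
Proof.
move=> z; have reC := @Re_continuous z; have imC := @Im_continuous z.
exact: (continuousD (continuousM reC reC) (continuousM imC imC)).
Qed.

Lemma esq_continuous n : continuous (@esq R n).
Proof.
move=> x; rewrite /esq; elim: (index_enum _) => [|i s IH].
  under eq_fun do rewrite big_nil; exact: cst_continuous.
under eq_fun do rewrite big_cons.
have ci : {for x, continuous (fun y : 'cV[R[i]]_n => csq (y i ord0))}.
  apply: continuous_comp; first exact: coord_continuous.
  exact: csq_continuous.
exact: (continuousD ci IH).
Qed.

Lemma compact_farthest n (K : set 'cV[R[i]]_n) : compact K -> K !=set0 ->
  exists2 p, K p & forall x, K x -> esq x <= esq p.
Proof.
move=> cK K0; have [|p /set_mem Kp Hp] := @compact_EVT_max _ _ (@esq R n) K K0 cK.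
  by apply: continuous_subspaceT; exact: esq_continuous.
by exists p => // x Kx; apply: Hp; apply/mem_set.
Qed.

Lemma interior_line n (K : set 'cV[R[i]]_n) y : K° y ->
  forall w, exists e, 0 < e /\ forall z, csq z <= e -> K (y + z *: w).
Proof.
move=> /nbhs_ballP [[e e'] /= e0 H] w.
(* Radii of balls are elements of [R[i]]; a positive one has zero imaginary part and positive real
   part. *)
have [e'0 {}e0]: e' = 0 /\ 0 < e by move: e0; rewrite ltcE /= => /andP[/eqP].
rewrite e'0 in H.
pose m := 1 + \sum_i csq (w i 0).
have m0 : 0 < m by rewrite ltr_wpDr // sumr_ge0 // => i _; exact: csq_ge0.
exists (e ^+ 2 / (2 * m)); split; first by rewrite divr_gt0 ?exprn_gt0 ?mulr_gt0.
move=> z hz; apply: H; split; first by rewrite ltcR.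
move=> i j; rewrite ord1 !mxE /ball /= opprD addrA subrr add0r normrN.
rewrite (normc_lt _ (ltW e0)) csqM.
have wm : csq (w i 0) <= m.
  rewrite /m (bigD1 i) //= addrCA lerDl addr_ge0 // sumr_ge0 // => k _; exact: csq_ge0.
apply: (@le_lt_trans _ _ (e ^+ 2 / (2 * m) * m)).
  by apply: ler_pM => //; exact: csq_ge0.
have -> : e ^+ 2 / (2 * m) * m = e ^+ 2 / 2 by field; rewrite gt_eqF.
by rewrite ltr_pdivrMr // ltr_pMr ?exprn_gt0 // ltr1n.
Qed.
End Topology.

(** * Ellipsoids *)

Section HermitianGauge.
Context {R : realType} {V : lmodType R[i]} (K : V -> Prop) (l : {scalar V}) (u y0 : V).
Hypothesis K0 : K 0.
Hypothesis Kl : forall y, K y -> y != 0 -> 0 < complex.Re (l y).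
Hypothesis Kline : forall a v, v != 0 ->
  exists c k, forall z, K (a + z *: v) <-> csq (z - c) <= k.
Hypothesis lu : l u = 1.
Hypothesis y0_neq0 : y0 != 0.
Hypothesis Kint : forall w, exists e, 0 < e /\ forall z, csq z <= e -> K (y0 + z *: w).

(** [F] is the homogenization of the [Q] of [chart_gauge]. Where [l y != 0], writing [y] as [l y]
    times the chart image of [y / l y] translates the gauge condition; on [l = 0], [F y] is the
    leading coefficient of [Q] along [y], hence positive for [y != 0]. *)
Lemma hermitian_gauge : exists F : V -> R, [/\
  forall a b, exists c, forall t : R, F (a + t%:C *: b) = F a + t * c + t ^+ 2 * F b,
  forall z y, F (z *: y) = csq z * F y,
  forall y, y != 0 -> 0 < F y &
  forall y, K y <-> F y <= complex.Re (l y)].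
Proof.
have [Q [Q_gt0 Qproj KQ Qline]] := chart_gauge K0 Kl Kline lu y0_neq0 Kint.
have HQ a b : exists al be ga de, forall x y,
    Q (a + Complex x y *: b) = al * (x ^+ 2 + y ^+ 2) + be * x + ga * y + de.
  have [b0|/Qline-/(_ a)[al [be [ga [de [_ H]]]]]] := eqVneq (b - l b *: u) 0; last first.
    by exists al, be, ga, de.
  (* The direction [b] is a multiple of [u] here, and [Q] is constant along [u]. *)
  exists 0, 0, 0, (Q a) => x y; rewrite Qproj [in RHS]Qproj !mul0r !add0r; congr Q.
  set z := Complex x y; rewrite [l (_ + _)]linearD [l (_ *: _)]linearZ /= scalerDl -scalerA.
  by rewrite opprD addrACA -scalerBr b0 scaler0 addr0.
have F0 y : l y = 0 -> homogenization Q l y = even_part Q y.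
  move=> ly; rewrite /homogenization ly conjc0 scale0r csq0 mulr0.
  by rewrite /odd_part oppr0 subrr mul0r !addr0.
have F_gt0 y : y != 0 -> 0 < homogenization Q l y.
  move=> yn0; have [ly|ly] := eqVneq (l y) 0; last first.
    by rewrite homogenizationE // mulr_gt0 ?csq_gt0.
  have [|al [be [ga [de [al0 H]]]]] := Qline 0 y; first by rewrite ly scale0r subr0.
  have H1 : Q y = al + be + de.
    by have := H 1 0; rewrite (_ : Complex 1 0 = 1) // scale1r add0r => ->; ring.
  have HN : Q (- y) = al - be + de.
    have := H (-1) 0; rewrite (_ : Complex (-1) 0 = -1) ?scaleN1r ?add0r => [->|]; first by ring.
    by apply/eqP; rewrite eq_complex /= oppr0 !eqxx.
  have HZ : Q 0 = de.
    by have := H 0 0; rewrite (_ : Complex 0 0 = 0) // scale0r add0r => ->; ring.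
  by rewrite F0 // /even_part H1 HN HZ; lra.
exists (homogenization Q l); split=> //.
- exact: homogenization_line.
- exact: homogenizationZ.
move=> y; have [ly|ly] := eqVneq (l y) 0.
  have [->|yn0] := eqVneq y 0.
    by rewrite F0 ?linear0 // /even_part oppr0; split=> // _ /=; lra.
  by split=> [/Kl/(_ yn0)|]; [rewrite ly ltxx|rewrite ly leNgt F_gt0].
rewrite homogenizationE // mulrC -KQ.
suff -> : l y *: chart l u ((l y)^-1 *: y) = y by [].
rewrite /chart [l (_ *: _)]linearZ /= mulVf // scale1r addrCA subrr addr0.
by rewrite scalerA divff // scale1r.
Qed.

End HermitianGauge.

(** * The Hermitian inner product and sections by complex lines *)

Section Esq.
Context {R : realType} {n : nat}.
Implicit Types (x y v : 'cV[R[i]]_n).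

(** The conjugate sits on the first argument so that [cdot x] is complex linear and can play the
    role of [l]. *)
Definition cdot x y : R[i] := \sum_i conjc (x i ord0) * y i ord0.

Lemma cdotD x y z : cdot x (y + z) = cdot x y + cdot x z.
Proof. by rewrite -big_split; apply: eq_bigr => i _; rewrite mxE mulrDr. Qed.

Lemma cdotZ x c y : cdot x (c *: y) = c * cdot x y.
Proof. by rewrite big_distrr; apply: eq_bigr => i _ /=; rewrite mxE mulrCA. Qed.

HB.instance Definition _ x := @GRing.isLinear.Build R[i] 'cV[R[i]]_n R[i] *%R (cdot x)
  (fun c y z => etrans (cdotD x (c *: y) z) (congr1 (+%R^~ _) (cdotZ x c y))).

Lemma cdot_esq x : cdot x x = (esq x)%:C.
Proof.
rewrite /cdot /esq rmorph_sum; apply: eq_bigr => i _.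
case: (x i ord0) => a b; apply/eqP; rewrite eq_complex /csq /=.
by apply/andP; split; apply/eqP; ring.
Qed.

Lemma esq_ge0 x : 0 <= esq x.
Proof. by apply: sumr_ge0 => i _; exact: csq_ge0. Qed.

Lemma esq_eq0 x : (esq x == 0) = (x == 0).
Proof.
rewrite psumr_eq0; last by move=> i _; exact: csq_ge0.
apply/allP/eqP => [H|-> i _ /=]; last by rewrite mxE csq0.
apply/matrixP => i j; rewrite ord1 mxE; apply/eqP.
by rewrite -csq_eq0; apply: H; rewrite mem_index_enum.
Qed.

Lemma esq_gt0 x : (0 < esq x) = (x != 0).
Proof. by rewrite lt_neqAle esq_ge0 andbT eq_sym esq_eq0. Qed.

Lemma esqZ z x : esq (z *: x) = csq z * esq x.
Proof. by rewrite big_distrr; apply: eq_bigr => i _ /=; rewrite mxE csqM. Qed.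

Lemma esqD x y : esq (x + y) = esq x + 2 * complex.Re (cdot x y) + esq y.
Proof.
rewrite /esq /cdot raddf_sum /= big_distrr /= -!big_split /=; apply: eq_bigr => i _.
rewrite mxE csqD; congr (_ + _ * _ + _); by case: (x i ord0) (y i ord0) => [a b] [c d] /=; ring.
Qed.

Lemma esqN x : esq (- x) = esq x.
Proof. by apply: eq_bigr => i _; rewrite mxE csqN. Qed.

Lemma cdotNl x y : cdot (- x) y = - cdot x y.
Proof. by rewrite /cdot -sumrN; apply: eq_bigr => i _; rewrite mxE rmorphN mulNr. Qed.

(** The parametrization scales squared distances by [esq v]; the sign of [k] distinguishes the empty
    set, a point and a disc. *)
Lemma line_section_iff (K : set 'cV[R[i]]_n) a v : v != 0 ->
  (complex_line a v `&` K = set0 \/ (exists p, complex_line a v `&` K = [set p]) \/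
    is_disk_in (complex_line a v) (complex_line a v `&` K)) <->
  exists c k, forall z, K (a + z *: v) <-> csq (z - c) <= k.
Proof.
move=> v0; have ev : 0 < esq v by rewrite esq_gt0.
have inL z : complex_line a v (a + z *: v) by exists z.
have lineB z w : a + z *: v - (a + w *: v) = (z - w) *: v.
  by rewrite opprD addrACA subrr add0r scalerBl.
have inj z w : a + z *: v = a + w *: v -> z = w.
  move=> /eqP; rewrite -subr_eq0 lineB scaler_eq0 (negbTE v0) orbF subr_eq0.
  by move/eqP.
split.
  case=> [E|[[p E]|[c [r [[w _ <-] [r0 E]]]]]].
  - exists 0, (-1) => z; split=> [Kz|h].
      by have : set0 (a + z *: v) by rewrite -E.
    by have := csq_ge0 (z - 0); lra.
  - have : (complex_line a v `&` K) p by rewrite E.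
    move=> [[w _ wE] Kp]; exists w, 0 => z; split=> [Kz|].
      have : [set p] (a + z *: v) by rewrite -E.
      by rewrite /= -wE => /inj ->; rewrite subrr csq0.
    move=> h; have /eqP : csq (z - w) == 0 by rewrite eq_le h csq_ge0.
    by move/eqP; rewrite csq_eq0 subr_eq0 => /eqP ->; rewrite wE.
  - exists w, (r ^+ 2 / esq v) => z; rewrite ler_pdivlMr // -esqZ -lineB.
    split=> [Kz|h].
      by have : (complex_line a v `&` K) (a + z *: v) by []; rewrite E => -[].
    have : (complex_line a v `&` K) (a + z *: v) by rewrite E; split.
    by case.
move=> [c [k Hk]]; have [k0|k0|k0] := ltrgtP k 0.
- left; apply/seteqP; split=> // _ [[z _ <-]] /Hk h.
  by have := csq_ge0 (z - c); lra.
- right; right; exists (a + c *: v), (Num.sqrt (k * esq v)); split=> //; split.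
    by rewrite sqrtr_gt0 mulr_gt0.
  rewrite sqr_sqrtr ?mulr_ge0 ?ltW //.
  apply/seteqP; split=> _ [[z _ <-]] h; split=> //; move: h.
    by move=> /Hk; rewrite lineB esqZ ler_pM2r.
  by rewrite lineB esqZ ler_pM2r // => /Hk.
- right; left; exists (a + c *: v); apply/seteqP; split=> [_ [[z _ <-]] /Hk|_ ->].
    rewrite k0 => h; have : csq (z - c) == 0 by rewrite eq_le h csq_ge0.
    by rewrite csq_eq0 subr_eq0 => /eqP ->.
  by split=> //; apply/Hk; rewrite subrr csq0 k0.
Qed.

Lemma esq_line_disc (s t : 'cV[R[i]]_n) : t != 0 ->
  exists c k, forall z, esq (s + z *: t) <= 1 <-> csq (z - c) <= k.
Proof.
move=> t0; have et : 0 < esq t by rewrite esq_gt0.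
pose q := cdot s t; pose e := (esq t)^-1.
exists (- (e%:C * conjc q)), (csq q * e ^+ 2 + (1 - esq s) * e) => z.
rewrite esqD esqZ cdotZ -/q opprK csqD csqM csq_conj csq_real.
have -> : complex.Re (z * conjc (e%:C * conjc q)) = complex.Re (z * q) * e.
  by case: z q => [a b] [c d] /=; ring.
rewrite -[X in _ <-> is_true X](ler_pM2l et); set r := complex.Re _.
have -> : esq t * (csq q * e ^+ 2 + (1 - esq s) * e) = csq q * e + (1 - esq s).
  by rewrite /e; field; rewrite gt_eqF.
have -> : esq t * (csq z + 2 * (r * e) + e ^+ 2 * csq q) = csq z * esq t + 2 * r + csq q * e.
  by rewrite /e; field; rewrite gt_eqF.
by split; lra.
Qed.

Lemma ellipsoid_line_disc (K : set 'cV[R[i]]_n) a v : is_ellipsoid K -> v != 0 ->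
  exists c k, forall z, K (a + z *: v) <-> csq (z - c) <= k.
Proof.
move=> [A [b [Au ->]]] v0.
have t0 : invmx A *m v != 0.
  by apply: contraNneq v0 => h; rewrite -[v](mulKVmx Au) h mulmx0.
have [c [k Hk]] := esq_line_disc (invmx A *m (a - b)) t0.
exists c, k => z; rewrite -Hk scalemxAr -mulmxDr addrAC; split.
  by move=> [y /= yb <-]; rewrite addrK mulKmx.
by move=> h; eexists; first exact: h; rewrite mulKVmx // subrK.
Qed.

End Esq.

(** * Ellipsoids from positive definite forms *)

Section EllipsoidOfForm.
Context {R : realType} {n : nat} (F : 'cV[R[i]]_n -> R) (l : {scalar 'cV[R[i]]_n}).
Hypothesis F_line : forall a b, exists c, forall t : R,
  F (a + t%:C *: b) = F a + t * c + t ^+ 2 * F b.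
Hypothesis FZ : forall z y, F (z *: y) = csq z * F y.
Hypothesis F_gt0 : forall y, y != 0 -> 0 < F y.

(** The diagonal coefficients are values of [F] at nonzero vectors, hence positive; their square
    roots rescale the coordinates that diagonalize [F]. *)
Lemma form_esq : exists B, B \in unitmx /\ forall y, F y = esq (B *m y).
Proof.
have [U [d [Uu FE]]] := hermitian_form_diag F_line FZ.
have d0 i : 0 < d i.
  have e0 : delta_mx i 0 != 0 :> 'cV[R[i]]_n.
    by apply/eqP => /matrixP /(_ i 0); rewrite !mxE !eqxx => /eqP; rewrite oner_eq0.
  have : 0 < F (invmx U *m delta_mx i 0).
    apply: F_gt0; apply: contraNneq e0 => h.
    by rewrite -[delta_mx i 0](mulKVmx Uu) h mulmx0.
  rewrite FE mulKVmx // (bigD1 i) //= big1 ?addr0 => [|j ji]; rewrite !mxE.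
    by rewrite !eqxx csq1 mulr1.
  by rewrite (negbTE ji) csq0 mulr0.
pose D : 'rV[R[i]]_n := \row_i (Num.sqrt (d i))%:C.
exists (diag_mx D *m U); split.
  rewrite unitmx_mul Uu andbT unitmxE det_diag unitfE; apply/prodf_neq0 => i _.
  by rewrite mxE -csq_eq0 csq_real sqr_sqrtr ?ltW // gt_eqF.
move=> y; rewrite FE; apply: eq_bigr => i _.
by rewrite -mulmxA mul_diag_mx [in RHS]mxE csqM [D _ _]mxE csq_real sqr_sqrtr // ltW.
Qed.

(** In the coordinates [w = B y] the condition is [|w|^2 <= 2 Re <h, w>], the ball of centre [h]
    with the origin on its boundary; [l u = 1] prevents [h = 0]. *)
Lemma ellipsoid_of_form (K : set 'cV[R[i]]_n) p u : l u = 1 ->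
  (forall y, K (p + y) <-> F y <= complex.Re (l y)) -> is_ellipsoid K.
Proof.
move=> lu HK; have [B [Bu FE]] := form_esq.
pose C := invmx B.
pose h : 'cV[R[i]]_n := \col_i (conjc (l (C *m delta_mx i 0)) * (2^-1)%:C).
have lC w : complex.Re (l (C *m w)) = 2 * complex.Re (cdot h w).
  have -> : l (C *m w) = \sum_i w i 0 * l (C *m delta_mx i 0).
    rewrite {1}[w]matrix_sum_delta mulmx_sumr linear_sum; apply: eq_bigr => i _.
    by rewrite big_ord1 -scalemxAr linearZ.
  rewrite /cdot !raddf_sum big_distrr /=; apply: eq_bigr => i _; rewrite mxE.
  by case: (w i ord0) (l _) => [a b] [c d] /=; field.
have key w : K (p + C *m w) <-> esq (w - h) <= esq h.
  rewrite HK FE mulKVmx // lC [w - h]addrC esqD esqN cdotNl.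
  have -> : complex.Re (- cdot h w) = - complex.Re (cdot h w) by case: cdot.
  by split; lra.
have h0 : 0 < esq h.
  rewrite esq_gt0; apply/eqP => h0; have := lC (B *m u).
  rewrite mulKmx // lu h0 /cdot big1 => [/= /eqP|i _]; last by rewrite mxE conjc0 mul0r.
  by rewrite mulr0 oner_eq0.
pose r := Num.sqrt (esq h).
have r0 : r%:C != 0 :> R[i] by rewrite -csq_eq0 csq_real sqr_sqrtr ?ltW // gt_eqF.
exists (r%:C *: C), (p + C *m h); split.
  by rewrite unitmxZ ?unitfE // unitmx_inv.
have rE : csq r%:C = esq h by rewrite csq_real sqr_sqrtr // ltW.
apply/seteqP; split=> [x Kx|_ [z /= zb <-]].
  pose w := B *m (x - p); have xE : x = p + C *m w by rewrite mulKmx // addrC subrK.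
  exists (r%:C^-1 *: (w - h)) => /=.
    rewrite /unit_ball /= esqZ csqV rE mulrC ler_pdivrMr // mul1r.
    by apply/key; rewrite -xE.
  by rewrite -scalemxAl -scalemxAr scalerA divff // scale1r mulmxBr addrCA subrK.
have -> : r%:C *: C *m z + (p + C *m h) = p + C *m (r%:C *: z + h).
  by rewrite mulmxDr -scalemxAl -scalemxAr addrCA.
by apply/key; rewrite addrK esqZ rE ler_piMr // ltW.
Qed.

End EllipsoidOfForm.

Unset Implicit Arguments.

Theorem theorem3p1 (R : realType) (n : nat) (K : set 'cV[R[i]]_n) :
  convex_body K ->
  (is_ellipsoid K <->
   forall L : set 'cV[R[i]]_n, is_complex_line L ->
     (L `&` K = set0) \/
     (exists p, L `&` K = [set p]) \/
     is_disk_in L (L `&` K)).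
Proof.
move=> [cK [_ [y Ky]]]; split=> [ellK L [a [v [v0 ->]]]|HL].
  by apply/line_section_iff => //; exact: ellipsoid_line_disc.
have Kline a v : v != 0 -> exists c k, forall z, K (a + z *: v) <-> csq (z - c) <= k.
  by move=> v0; apply/line_section_iff => //; apply: HL; exists a, v.
have Kint := interior_line Ky.
have Ky' : K y.
  by have [e [e0 /(_ 0)]] := Kint 0; rewrite csq0 scaler0 addr0; apply; exact: ltW.
have [p Kp Hp] := compact_farthest cK (ex_intro _ y Ky').
case: n K cK y Ky HL Kline Kint Ky' p Kp Hp => [|n] K cK y Ky HL Kline Kint Ky' p Kp Hp.
  (* [C^0] is a single point, so [K], which contains [y], is the unit ball. *)
  exists 1%:M, 0; split; first exact: unitmx1.
  apply/seteqP; split=> x _.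
    exists 0; last by apply/matrixP => -[].
    by rewrite /unit_ball /= /esq big_ord0 ler01.
  by rewrite (_ : x = y) //; apply/matrixP => -[].
(* If the farthest point were [0], then [K] would be reduced to [0], which has no interior in
   positive dimension. *)
have p0 : 0 < esq p.
  rewrite lt_neqAle esq_ge0 andbT; apply/eqP => p0.
  have K00 x : K x -> x = 0.
    by move=> /Hp; rewrite -p0 => h; apply/eqP; rewrite -esq_eq0 eq_le h esq_ge0.
  have [e [e0 He]] := Kint (const_mx 1).
  have := K00 _ (He (Num.sqrt e)%:C ltac:(by rewrite csq_real sqr_sqrtr // ltW)).
  rewrite (K00 _ Ky') add0r => /matrixP /(_ 0 0); rewrite !mxE mulr1 => /complexI /eqP.
  by rewrite gt_eqF // sqrtr_gt0.
pose u := (esq p)^-1%:C *: - p.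
(* An interior point is never farthest: it can be pushed outwards along [p]. *)
have yp : y - p != 0.
  rewrite subr_eq0; apply/eqP => yp; have [e [e0 He]] := Kint p.
  have := Hp _ (He (Num.sqrt e)%:C ltac:(by rewrite csq_real sqr_sqrtr // ltW)).
  rewrite yp -{1}[p]scale1r -scalerDl esqZ leNgt ltr_pMl //.
  have : 0 < Num.sqrt e by rewrite sqrtr_gt0.
  move: (Num.sqrt e) => s s0; have := sqr_ge0 s.
  by rewrite (_ : csq (1 + s%:C) = 1 + 2 * s + s ^+ 2); [lra|rewrite /csq /=; ring].
have [F [F_line FZ F_gt0 KF]] : exists F : 'cV[R[i]]_n.+1 -> R, [/\
    forall a b, exists c, forall t : R, F (a + t%:C *: b) = F a + t * c + t ^+ 2 * F b,
    forall z y, F (z *: y) = csq z * F y,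
    forall y, y != 0 -> 0 < F y &
    forall y, K (p + y) <-> F y <= complex.Re (cdot (- p) y)].
  apply: (@hermitian_gauge _ _ (fun y => K (p + y)) (cdot (- p)) u (y - p)) => //.
  - by rewrite addr0.
  (* [|p + x|^2 <= |p|^2] says [|x|^2 <= 2 Re <-p, x>], and [|x|^2] is positive for [x != 0]. *)
  - move=> x /Hp; rewrite esqD -esq_gt0 /= cdotNl => h1 h2.
    by rewrite (_ : complex.Re (- _) = - complex.Re (cdot p x)); [lra|case: cdot].
  - by move=> a v v0; have [c [k H]] := Kline (p + a) v v0; exists c, k => z; rewrite addrA.
  - rewrite /u linearZ /= cdot_esq esqN -rmorphM /= mulVf // gt_eqF //.
  - move=> w; have [e [e0 He]] := Kint w; exists e; split=> // z /He.
    by rewrite addrA addrCA subrr addr0.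
apply: (@ellipsoid_of_form _ _ F (cdot (- p)) F_line FZ F_gt0 K p u) => //.
by rewrite /u linearZ /= cdot_esq esqN -rmorphM /= mulVf // gt_eqF.
Qed.
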